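(* There is a computable infinite tournament $T$ with no infinite transitive subtournament that is $\Delta^0_2$, and hence no infinite transitive subtournament that is $\Sigma^0_2$ and none that is low.
   Context: An infinite tournament is an irreflexive binary relation $T$ on $\mathbb{N}$ such that for all $x\neq y$ exactly one of $T(x,y)$, $T(y,x)$ holds. An infinite transitive subtournament of $T$ is an infinite set $S\subseteq\mathbb{N}$ such that for all $x,y,z\in S$, $T(x,y)$ and $T(y,z)$ imply $T(x,z)$. A set is $\Delta^0_2$ / $\Sigma^0_2$ / low in the usual computability-theoretic sense (low: $S'\leq_T \emptyset'$). *)

(* Defs.v *)
From Stdlib Require Import Arith Lia List Cantor.

Definition pair (x y : nat) : nat := Cantor.to_nat (x, y).

Notation "<< x , y >>" := (pair x y) (at level 0, x at level 99, y at level 99).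

Lemma pair_inj x y x' y' : <<x, y>> = <<x', y'>> -> x = x' /\ y = y'.
Proof.
  unfold pair; intros E; apply Cantor.to_nat_inj in E; inversion E; auto.
Qed.

Definition empty : nat -> Prop := fun _ => False.

(** Programs for the functions that are partial recursive in an oracle, in the
    unary presentation: several arguments are packed with the Cantor pairing,
    and [Pair], [Fst], [Snd] stand for the pairing and its projections. *)
Inductive code : Type :=
| Zero | Succ | Fst | Snd
| Query
| Pair (f g : code)
| Comp (f g : code)
| Prec (f g : code)
| Mu (f : code).

(** [eval A c x y]: with oracle [A], program [c] halts on input [x] with output
    [y].  In [eval_Mu] the function [k] supplies the nonzero values
    [k m + 1] that [f] takes before its first zero. *)
Inductive eval (A : nat -> Prop) : code -> nat -> nat -> Prop :=
| eval_Zero x : eval A Zero x 0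
| eval_Succ x : eval A Succ x (S x)
| eval_Fst x y : eval A Fst <<x, y>> x
| eval_Snd x y : eval A Snd <<x, y>> y
| eval_Query_in x : A x -> eval A Query x 1
| eval_Query_out x : ~ A x -> eval A Query x 0
| eval_Pair f g x y z :
    eval A f x y -> eval A g x z -> eval A (Pair f g) x <<y, z>>
| eval_Comp f g x y z :
    eval A g x y -> eval A f y z -> eval A (Comp f g) x z
| eval_Prec_0 f g x y :
    eval A f x y -> eval A (Prec f g) <<x, 0>> y
| eval_Prec_S f g x n y z :
    eval A (Prec f g) <<x, n>> y -> eval A g <<x, <<n, y>>>> z ->
    eval A (Prec f g) <<x, S n>> z
| eval_Mu f x n (k : nat -> nat) :
    (forall m, m < n -> eval A f <<x, m>> (S (k m))) ->
    eval A f <<x, n>> 0 ->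
    eval A (Mu f) x n.

Lemma eval_det A c x y : eval A c x y -> forall z, eval A c x z -> y = z.
Proof.
  intros H; induction H; intros w Hw;
    match type of Hw with eval _ _ ?p _ => remember p as q eqn:Q end;
    inversion Hw; subst; try tauto; clear Hw;
    repeat match goal with
    | E : << _ , _ >> = << _ , _ >> |- _ =>
        apply pair_inj in E; destruct E; subst
    | E : S _ = S _ |- _ => injection E as E; subst
    end; auto; try discriminate.
  - match goal with G : eval A g x _, F : eval A f _ w |- _ =>
      apply IHeval1 in G; subst; auto end.
  - match goal with
      P : eval A (Prec f g) _ ?v, G : eval A g <<_, <<_, ?v>> >> w |- _ =>
      apply IHeval1 in P; subst; auto end.
  - destruct (Nat.lt_trichotomy n w) as [L | [L | L]]; auto; exfalso.
    + match goal with K : forall m, m < w -> eval _ _ _ _ |- _ =>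
        apply K, IHeval in L; discriminate end.
    + match goal with Z : eval A f <<x, w>> 0 |- _ =>
        apply (H0 w L) in Z; discriminate end.
Qed.

Fixpoint encode (c : code) : nat :=
  match c with
  | Zero => 0
  | Succ => 1
  | Fst => 2
  | Snd => 3
  | Query => 4
  | Pair f g => 5 + 4 * <<encode f, encode g>>
  | Comp f g => 6 + 4 * <<encode f, encode g>>
  | Prec f g => 7 + 4 * <<encode f, encode g>>
  | Mu f => 8 + 4 * encode f
  end.

Lemma encode_inj c d : encode c = encode d -> c = d.
Proof.
  revert d; induction c; intros [] E; cbn [encode] in E; try lia; auto;
    f_equal; auto;
    try (assert (Q : <<encode c1, encode c2>> = <<encode f, encode g>>) by lia;
         apply pair_inj in Q; destruct Q; auto).
  apply IHc; lia.
Qed.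

Lemma encode_surj n : exists c, encode c = n.
Proof.
  induction n as [n IH] using lt_wf_ind.
  destruct (le_lt_dec 5 n) as [L | L].
  - pose proof (Nat.div_mod (n - 5) 4 ltac:(lia)) as D.
    pose proof (Nat.mod_upper_bound (n - 5) 4 ltac:(lia)) as B.
    remember ((n - 5) / 4) as q; remember ((n - 5) mod 4) as r.
    destruct (Nat.eq_dec r 3) as [E | E].
    + destruct (IH q ltac:(lia)) as [c Hc].
      exists (Mu c); cbn [encode]; lia.
    + destruct (Cantor.of_nat q) as [a b] eqn:Q.
      apply (f_equal Cantor.to_nat) in Q; rewrite Cantor.cancel_to_of in Q.
      change (q = <<a, b>>) in Q.
      pose proof (Cantor.to_nat_non_decreasing a b) as M.
      change (b + a <= <<a, b>>) in M.
      destruct (IH a ltac:(lia)) as [c Hc].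
      destruct (IH b ltac:(lia)) as [d Hd].
      assert (r = 0 \/ r = 1 \/ r = 2) as [R | [R | R]] by lia;
        [exists (Pair c d) | exists (Comp c d) | exists (Prec c d)];
        cbn [encode]; rewrite Hc, Hd; lia.
  - assert (n = 0 \/ n = 1 \/ n = 2 \/ n = 3 \/ n = 4) as N by lia.
    destruct N as [-> | [-> | [-> | [-> | ->]]]];
      [exists Zero | exists Succ | exists Fst | exists Snd | exists Query];
      reflexivity.
Qed.

Definition turing_le (A B : nat -> Prop) : Prop :=
  exists c, forall x, (A x -> eval B c x 1) /\ (~ A x -> eval B c x 0).

(** Relative to [empty], [Query] is just the constant function 0. *)
Definition computable (A : nat -> Prop) : Prop := turing_le A empty.

Definition computable2 (R : nat -> nat -> Prop) : Prop :=
  computable (fun p => let (x, y) := Cantor.of_nat p in R x y).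

Definition computable3 (R : nat -> nat -> nat -> Prop) : Prop :=
  computable2 (fun x q => let (u, v) := Cantor.of_nat q in R x u v).

Definition Sigma02 (A : nat -> Prop) : Prop :=
  exists R, computable3 R /\ forall x, A x <-> exists u, forall v, R x u v.

Definition Pi02 (A : nat -> Prop) : Prop :=
  exists R, computable3 R /\ forall x, A x <-> forall u, exists v, R x u v.

Definition Delta02 (A : nat -> Prop) : Prop := Sigma02 A /\ Pi02 A.

(** The diagonal halting set; [encode] is a bijection, so every [e] is the
    index of exactly one program. *)
Definition jump (A : nat -> Prop) : nat -> Prop :=
  fun e => exists c, encode c = e /\ exists y, eval A c e y.

Definition low (A : nat -> Prop) : Prop := turing_le (jump A) (jump empty).

Definition infinite (A : nat -> Prop) : Prop :=
  ~ exists l : list nat, forall x, A x -> In x l.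

Definition tournament (T : nat -> nat -> Prop) : Prop :=
  (forall x, ~ T x x) /\
  (forall x y, x <> y -> (T x y /\ ~ T y x) \/ (~ T x y /\ T y x)).

Definition infinite_transitive_subtournament
    (T : nat -> nat -> Prop) (S : nat -> Prop) : Prop :=
  infinite S /\
  forall x y z, S x -> S y -> S z -> T x y -> T y z -> T x z.

(* Main.v *)
(** A [Sigma02] set [S = {x | exists u, forall v, R x u v}] has a computable
    approximation by witnesses [p = <<x, u>>]: a false witness is eventually
    refuted, a true one never is.  Row [s] of the tournament orients [s] against
    the smaller numbers.  For each [e < s] in turn it takes the first two
    unrefuted witnesses of the [e]-th [Sigma02] set that name distinct numbers
    not used for a smaller index, orients this pair as [a -> b] by the earlier
    rows, and puts [b -> s -> a].  At most [2e] numbers are used before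
    index [e], so if the [e]-th set [S] is infinite, then at all large [s] both
    numbers come from a fixed finite set of true witnesses; any such [s] in [S]
    closes a 3-cycle inside [S].

    A low set is computable from its jump, hence from the halting problem, and
    running that computation against the stages of the halting problem shows
    that it is [Sigma02]. *)

Require Import Defs.
From Stdlib Require Import Arith Lia List Cantor Bool Classical.

(** * Projections of the Cantor pairing, primitive recursion and bounded search *)

Definition pi1 (n : nat) : nat := fst (Cantor.of_nat n).
Definition pi2 (n : nat) : nat := snd (Cantor.of_nat n).

Lemma pi1_pair x y : pi1 <<x, y>> = x.
Proof. unfold pi1, pair; now rewrite Cantor.cancel_of_to. Qed.

Lemma pi2_pair x y : pi2 <<x, y>> = y.
Proof. unfold pi2, pair; now rewrite Cantor.cancel_of_to. Qed.

Lemma pair_eta n : <<pi1 n, pi2 n>> = n.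
Proof.
  unfold pi1, pi2, pair; rewrite <- surjective_pairing; apply Cantor.cancel_to_of.
Qed.

Lemma pi1_le n : pi1 n <= n.
Proof.
  pose proof (Cantor.to_nat_non_decreasing (pi1 n) (pi2 n)) as L.
  change (pi2 n + pi1 n <= <<pi1 n, pi2 n>>) in L; rewrite pair_eta in L; lia.
Qed.

Opaque pair pi1 pi2.

Fixpoint primrec (a : nat) (h : nat -> nat -> nat) (n : nat) : nat :=
  match n with 0 => a | S m => h m (primrec a h m) end.

(** The search is an iteration that stops moving at the first hit, so it is recursive because
    iteration is. The value [n] means that no number below [n] satisfies [P]. *)
Definition least (n : nat) (P : nat -> bool) : nat :=
  Nat.iter n (fun y => if P y then y else S y) 0.

Lemma least_inv n P :
  least n P <= n /\ (least n P < n -> P (least n P) = true) /\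
  forall i, i < least n P -> P i = false.
Proof.
  induction n as [|n (A & B & C)]; [cbn; repeat split; lia|].
  change (least (S n) P)
    with (if P (least n P) then least n P else S (least n P)).
  destruct (P (least n P)) eqn:E.
  - repeat split; auto.
  - assert (least n P = n) as D.
    { destruct (Nat.eq_dec (least n P) n) as [|N]; auto.
      specialize (B ltac:(lia)); discriminate. }
    rewrite D in *; repeat split; try lia.
    intros i Hi; destruct (Nat.eq_dec i n) as [->|]; auto; apply C; lia.
Qed.

Lemma least_sat n P : least n P < n -> P (least n P) = true.
Proof. apply least_inv. Qed.

Lemma least_le n P i : P i = true -> least n P <= i.
Proof.
  intros H; destruct (least_inv n P) as (_ & _ & C).
  destruct (le_lt_dec (least n P) i) as [|L]; auto.
  rewrite C in H by auto; discriminate.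
Qed.

Definition any (n : nat) (P : nat -> bool) : bool := least n P <? n.

Lemma any_spec n P : any n P = true <-> exists i, i < n /\ P i = true.
Proof.
  unfold any; rewrite Nat.ltb_lt; split.
  - intros L; exists (least n P); split; auto using least_sat.
  - intros (i & Hi & HP); pose proof (least_le n P i HP); lia.
Qed.

(** * Total recursive functions *)

(** One code must serve every oracle, so that it can be composed with programs that query an
    arbitrary set or a jump. *)
Definition recursive (f : nat -> nat) : Prop :=
  exists c, forall A x, eval A c x (f x).

Definition recursiveb (b : nat -> bool) : Prop :=
  recursive (fun x => Nat.b2n (b x)).

Lemma recursive_ext f g : (forall x, f x = g x) -> recursive f -> recursive g.
Proof. intros E [c H]; exists c; intros A x; rewrite <- E; auto. Qed.

Lemma recursive_comp f g :
  recursive f -> recursive g -> recursive (fun x => f (g x)).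
Proof.
  intros [c H] [d K]; exists (Comp c d); intros A x; econstructor; eauto.
Qed.

Lemma recursive_pi1_id : recursive pi1.
Proof.
  exists Fst; intros A x; rewrite <- (pair_eta x) at 1; constructor.
Qed.

Lemma recursive_pi2_id : recursive pi2.
Proof.
  exists Snd; intros A x; rewrite <- (pair_eta x) at 1; constructor.
Qed.

Lemma recursive_pi1 f : recursive f -> recursive (fun x => pi1 (f x)).
Proof. apply recursive_comp, recursive_pi1_id. Qed.

Lemma recursive_pi2 f : recursive f -> recursive (fun x => pi2 (f x)).
Proof. apply recursive_comp, recursive_pi2_id. Qed.

Lemma recursive_S f : recursive f -> recursive (fun x => S (f x)).
Proof. apply recursive_comp; exists Succ; constructor. Qed.

Lemma recursive_pair f g :
  recursive f -> recursive g -> recursive (fun x => <<f x, g x>>).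
Proof.
  intros [c H] [d K]; exists (Pair c d); intros A x; constructor; auto.
Qed.

(** No constructor of [code] is the identity; surjectivity of the pairing recovers it from the two
    projections. *)
Lemma recursive_id : recursive (fun x => x).
Proof.
  apply (recursive_ext (fun x => <<pi1 x, pi2 x>>)); [apply pair_eta|].
  apply recursive_pair; [apply recursive_pi1_id|apply recursive_pi2_id].
Qed.

Lemma recursive_const n : recursive (fun _ => n).
Proof.
  induction n; [exists Zero; constructor|now apply recursive_S].
Qed.

Lemma recursive_app2 (o : nat -> nat -> nat) f g :
  recursive (fun p => o (pi1 p) (pi2 p)) -> recursive f -> recursive g ->
  recursive (fun x => o (f x) (g x)).
Proof.
  intros Ho Hf Hg.
  apply (recursive_ext (fun x => o (pi1 <<f x, g x>>) (pi2 <<f x, g x>>))).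
  { intros x; now rewrite pi1_pair, pi2_pair. }
  apply (recursive_comp (fun p => o (pi1 p) (pi2 p))); auto.
  now apply recursive_pair.
Qed.

(** [Prec] hands [<<x, <<k, y>>>>] to its second program, which dictates how [h] is uncurried; the
    input [x] stays available as a parameter throughout. *)
Lemma recursive_primrec a (h : nat -> nat -> nat -> nat) n :
  recursive a ->
  recursive (fun p => h (pi1 p) (pi1 (pi2 p)) (pi2 (pi2 p))) ->
  recursive n ->
  recursive (fun x => primrec (a x) (h x) (n x)).
Proof.
  intros [ca Ha] [ch Hh] Hn.
  apply (recursive_app2 (fun x k => primrec (a x) (h x) k) (fun x => x)); auto;
    [|apply recursive_id].
  exists (Prec ca ch); intros A p.
  rewrite <- (pair_eta p) at 1; generalize (pi1 p) as x; intros x.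
  induction (pi2 p) as [|k IH]; cbn.
  - constructor; auto.
  - econstructor; [exact IH|].
    specialize (Hh A <<x, <<k, primrec (a x) (h x) k>>>>).
    now rewrite !pi2_pair, !pi1_pair in Hh.
Qed.

Lemma recursive_iter a (h : nat -> nat -> nat) n :
  recursive a -> recursive (fun p => h (pi1 p) (pi2 p)) -> recursive n ->
  recursive (fun x => Nat.iter (n x) (h x) (a x)).
Proof.
  intros Ha Hh Hn.
  apply (recursive_ext (fun x => primrec (a x) (fun _ y => h x y) (n x))).
  { intros x; induction (n x) as [|k IH]; cbn; [|rewrite IH]; auto. }
  apply (recursive_primrec a (fun x _ y => h x y)); auto.
  apply (recursive_app2 h); auto; repeat apply recursive_pi2;
    auto using recursive_pi1, recursive_id.
Qed.

Lemma recursive_add f g :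
  recursive f -> recursive g -> recursive (fun x => f x + g x).
Proof.
  intros Hf Hg.
  apply (recursive_ext (fun x => Nat.iter (f x) S (g x))).
  { intros x; induction (f x) as [|k IH]; cbn; auto. }
  apply (recursive_iter g (fun _ y => S y)); auto.
  apply recursive_S, recursive_pi2_id.
Qed.

Lemma recursive_sub f g :
  recursive f -> recursive g -> recursive (fun x => f x - g x).
Proof.
  intros Hf Hg.
  apply (recursive_ext (fun x => Nat.iter (g x) pred (f x))).
  { intros x; induction (g x) as [|k IH]; [cbn|rewrite Nat.iter_succ, IH]; lia. }
  apply (recursive_iter f (fun _ y => pred y)); auto.
  (* The predecessor is a recursion that returns its counter and forgets the previous value. *)
  apply (recursive_ext (fun p => primrec 0 (fun i _ => i) (pi2 p))).
  { intros p; now destruct (pi2 p). }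
  apply (recursive_primrec (fun _ => 0) (fun _ i _ => i));
    auto using recursive_const, recursive_pi1, recursive_pi2, recursive_id.
Qed.

(** A case distinction is a primitive recursion of length 0 or 1. *)
Lemma recursive_if b f g :
  recursiveb b -> recursive f -> recursive g ->
  recursive (fun x => if b x then f x else g x).
Proof.
  intros Hb Hf Hg.
  apply (recursive_ext
           (fun x => primrec (g x) (fun _ _ => f x) (Nat.b2n (b x)))).
  { intros x; now destruct (b x). }
  apply (recursive_primrec g (fun x _ _ => f x)); auto.
  apply recursive_comp; auto using recursive_pi1_id.
Qed.

Lemma recursiveb_not b : recursiveb b -> recursiveb (fun x => negb (b x)).
Proof.
  intros H; apply (recursive_ext (fun x => if b x then 0 else 1));
    [intros x; now destruct (b x)|].
  apply recursive_if; auto using recursive_const.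
Qed.

Lemma recursiveb_and a b :
  recursiveb a -> recursiveb b -> recursiveb (fun x => a x && b x).
Proof.
  intros Ha Hb; apply (recursive_ext (fun x => if a x then Nat.b2n (b x) else 0));
    [intros x; now destruct (a x)|].
  apply recursive_if; auto using recursive_const.
Qed.

Lemma recursiveb_or a b :
  recursiveb a -> recursiveb b -> recursiveb (fun x => a x || b x).
Proof.
  intros Ha Hb; apply (recursive_ext (fun x => if a x then 1 else Nat.b2n (b x)));
    [intros x; now destruct (a x)|].
  apply recursive_if; auto using recursive_const.
Qed.

Lemma recursiveb_if b f g :
  recursiveb b -> recursiveb f -> recursiveb g ->
  recursiveb (fun x => if b x then f x else g x).
Proof.
  intros Hb Hf Hg.
  apply (recursive_ext
           (fun x => if b x then Nat.b2n (f x) else Nat.b2n (g x)));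
    [intros x; now destruct (b x)|].
  now apply recursive_if.
Qed.

Lemma recursiveb_leb f g :
  recursive f -> recursive g -> recursiveb (fun x => f x <=? g x).
Proof.
  intros Hf Hg; apply (recursive_ext (fun x => 1 - (f x - g x))).
  { intros x; destruct (Nat.leb_spec (f x) (g x)); cbn [Nat.b2n]; lia. }
  auto using recursive_sub, recursive_const.
Qed.

Lemma recursiveb_ltb f g :
  recursive f -> recursive g -> recursiveb (fun x => f x <? g x).
Proof.
  intros Hf Hg; apply (recursiveb_leb (fun x => S (f x))); auto using recursive_S.
Qed.

Lemma recursiveb_eqb f g :
  recursive f -> recursive g -> recursiveb (fun x => f x =? g x).
Proof.
  intros Hf Hg.
  apply (recursive_ext (fun x => Nat.b2n ((f x <=? g x) && (g x <=? f x)))).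
  { intros x; destruct (Nat.leb_spec (f x) (g x)), (Nat.leb_spec (g x) (f x)),
      (Nat.eqb_spec (f x) (g x)); auto; lia. }
  apply recursiveb_and; auto using recursiveb_leb.
Qed.

Lemma recursive_least n (P : nat -> nat -> bool) :
  recursive n -> recursiveb (fun p => P (pi1 p) (pi2 p)) ->
  recursive (fun x => least (n x) (P x)).
Proof.
  intros Hn HP.
  apply (recursive_iter (fun _ => 0) (fun x y => if P x y then y else S y));
    auto using recursive_const.
  apply recursive_if; auto using recursive_S, recursive_pi2_id.
Qed.

Lemma recursiveb_any n (P : nat -> nat -> bool) :
  recursive n -> recursiveb (fun p => P (pi1 p) (pi2 p)) ->
  recursiveb (fun x => any (n x) (P x)).
Proof.
  intros Hn HP; apply recursiveb_ltb; auto using recursive_least.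
Qed.

(** The two generic application cases come last, so that a known operation is taken apart by its own
    rule first. *)
Ltac recursion :=
  repeat
    (assumption ||
     lazymatch goal with
     | |- recursive (fun x => x) => apply recursive_id
     | |- recursive (fun _ => ?n) => apply recursive_const
     | |- recursive pi1 => apply recursive_pi1_id
     | |- recursive pi2 => apply recursive_pi2_id
     | |- recursive (fun x => pi1 (@?f x)) => apply (recursive_pi1 f)
     | |- recursive (fun x => pi2 (@?f x)) => apply (recursive_pi2 f)
     | |- recursive (fun x => <<@?f x, @?g x>>) => apply (recursive_pair f g)
     | |- recursive (fun x => S (@?f x)) => apply (recursive_S f)
     | |- recursive (fun x => @?f x + @?g x) => apply (recursive_add f g)
     | |- recursive (fun x => @?f x - @?g x) => apply (recursive_sub f g)
     | |- recursive (fun x => if _ then _ else _) => apply recursive_if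
     | |- recursive (fun x => least _ _) => apply recursive_least
     | |- recursive (fun x => Nat.iter _ _ _) => apply recursive_iter
     | |- recursive (fun x => primrec _ _ _) => apply recursive_primrec
     | |- recursiveb (fun x => negb (@?a x)) => apply (recursiveb_not a)
     | |- recursiveb (fun x => @?a x && @?b x) => apply (recursiveb_and a b)
     | |- recursiveb (fun x => @?a x || @?b x) => apply (recursiveb_or a b)
     | |- recursiveb (fun x => @?f x <? @?g x) => apply (recursiveb_ltb f g)
     | |- recursiveb (fun x => @?f x <=? @?g x) => apply (recursiveb_leb f g)
     | |- recursiveb (fun x => @?f x =? @?g x) => apply (recursiveb_eqb f g)
     | |- recursiveb (fun x => any _ _) => apply recursiveb_any
     | |- recursiveb (fun x => if _ then _ else _) => apply recursiveb_if
     | |- recursive (fun x => ?o (@?f x) (@?g x)) =>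
         apply (recursive_app2 o f g)
     | |- recursive (fun x => ?f (@?g x)) => apply (recursive_comp f g)
     end).

(** * Passage between recursive functions and computable relations *)

Lemma recursiveb_computable b :
  recursiveb b -> computable (fun x => b x = true).
Proof.
  intros [c H]; exists c; intros x; specialize (H empty x).
  destruct (b x); split; intros; auto; try discriminate; tauto.
Qed.

Transparent pi1 pi2.

Lemma recursiveb_computable2 (b : nat -> nat -> bool) :
  recursiveb (fun p => b (pi1 p) (pi2 p)) ->
  computable2 (fun x y => b x y = true).
Proof.
  intros H; destruct (recursiveb_computable _ H) as [c Hc].
  exists c; intros p; specialize (Hc p).
  unfold pi1, pi2 in Hc; now destruct (Cantor.of_nat p).
Qed.

Lemma recursiveb_computable3 (b : nat -> nat -> nat -> bool) :
  recursiveb (fun p => b (pi1 p) (pi1 (pi2 p)) (pi2 (pi2 p))) ->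
  computable3 (fun x u v => b x u v = true).
Proof.
  intros H; destruct (recursiveb_computable _ H) as [c Hc].
  exists c; intros p; specialize (Hc p).
  unfold pi1, pi2 in Hc; destruct (Cantor.of_nat p) as [x q]; cbn [fst snd] in Hc.
  now destruct (Cantor.of_nat q).
Qed.

Lemma computable3_code R :
  computable3 R ->
  exists c, forall p,
    (R (pi1 p) (pi1 (pi2 p)) (pi2 (pi2 p)) -> eval empty c p 1) /\
    (~ R (pi1 p) (pi1 (pi2 p)) (pi2 (pi2 p)) -> eval empty c p 0).
Proof.
  intros [c H]; exists c; intros p; specialize (H p).
  unfold pi1, pi2; destruct (Cantor.of_nat p) as [x q]; cbn [fst snd].
  now destruct (Cantor.of_nat q).
Qed.

Opaque pi1 pi2.

(** * A universal machine *)

(* The number [<<v, K>>] is a configuration: the value [v] is to be handed to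
   the top frame of the stack [K], which is [0] when empty. *)
Definition push (f K : nat) : nat := S <<f, K>>.
(** A frame says what to do with the incoming value [v]: run [c] on it; keep it as a left component
    and run [g] on [x]; pair it to the right of [u]; or treat it as the value of [f] at the search
    point [p]. *)
Definition fr_code (c : nat) : nat := <<0, c>>.
Definition fr_pair (g x : nat) : nat := <<1, <<g, x>>>>.
Definition fr_left (u : nat) : nat := <<2, u>>.
Definition fr_mu (f p : nat) : nat := <<3, <<f, p>>>>.

(** Division by 4, as a bounded search for the first [q] with [m < 4 * q + 4]. *)
Definition quarter (m : nat) : nat :=
  least m (fun q => m <? S (q + q + q + q + 3)).

Lemma quarter_spec q r : r < 4 -> quarter (r + 4 * q) = q.
Proof.
  intros L; unfold quarter; set (P := fun _ => _).
  destruct (least_inv (r + 4 * q) P) as (A & B & C).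
  destruct (lt_eq_lt_dec (least (r + 4 * q) P) q) as [[D|D]|D]; auto.
  - specialize (B ltac:(lia)); unfold P in B at 1; apply Nat.ltb_lt in B; lia.
  - specialize (C q D); unfold P in C; apply Nat.ltb_ge in C; lia.
Qed.

(** Arithmetic inversion of [encode]. In the successor case of [Prec], the two [fr_left] frames wrap
    the recursive value [y] into [<<x, <<n, y>>>>] before the second program runs. *)
Definition apply_code (o : nat -> nat) (c v K : nat) : nat :=
  if c =? 0 then <<0, K>>
  else if c =? 1 then <<S v, K>>
  else if c =? 2 then <<pi1 v, K>>
  else if c =? 3 then <<pi2 v, K>>
  else if c =? 4 then <<o v, K>>
  else
    let q := quarter (c - 5) in
    let r := c - 5 - (q + q + q + q) in
    if r =? 0 then
      <<v, push (fr_code (pi1 q)) (push (fr_pair (pi2 q) v) K)>>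
    else if r =? 1 then
      <<v, push (fr_code (pi2 q)) (push (fr_code (pi1 q)) K)>>
    else if r =? 2 then
      if pi2 v =? 0 then <<pi1 v, push (fr_code (pi1 q)) K>>
      else <<<<pi1 v, pi2 v - 1>>,
             push (fr_code c) (push (fr_left (pi2 v - 1))
               (push (fr_left (pi1 v)) (push (fr_code (pi2 q)) K)))>>
    else <<<<v, 0>>, push (fr_code q) (push (fr_mu q <<v, 0>>) K)>>.

Definition apply_frame (o : nat -> nat) (t d v K : nat) : nat :=
  if t =? 0 then apply_code o d v K
  else if t =? 1 then <<pi2 d, push (fr_code (pi1 d)) (push (fr_left v) K)>>
  else if t =? 2 then <<<<d, v>>, K>>
  else if v =? 0 then <<pi2 (pi2 d), K>>
  else
    let p := <<pi1 (pi2 d), S (pi2 (pi2 d))>> in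
    <<p, push (fr_code (pi1 d)) (push (fr_mu (pi1 d) p) K)>>.

(** A configuration with empty stack is a fixed point, so any step count beyond the halting time
    gives the same result. *)
Definition step (o : nat -> nat) (k : nat) : nat :=
  if pi2 k =? 0 then k
  else
    let F := pi2 k - 1 in
    apply_frame o (pi1 (pi1 F)) (pi2 (pi1 F)) (pi1 k) (pi2 F).

Definition run (o : nat -> nat) (t e x : nat) : nat :=
  Nat.iter t (step o) <<x, push (fr_code e) 0>>.

Lemma recursive_step (o : nat -> nat -> nat) k :
  recursive (fun p => o (pi1 p) (pi2 p)) -> recursive k ->
  recursive (fun x => step (o x) (k x)).
Proof.
  intros Ho Hk; unfold step, apply_frame, apply_code, quarter, push,
    fr_code, fr_pair, fr_left, fr_mu; cbv zeta; recursion.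
Qed.

Lemma recursive_run (o : nat -> nat -> nat) t e y :
  recursive (fun p => o (pi1 p) (pi2 p)) ->
  recursive t -> recursive e -> recursive y ->
  recursive (fun x => run (o x) (t x) (e x) (y x)).
Proof.
  intros Ho Ht He Hy; unfold run, push, fr_code; recursion.
  apply (recursive_step (fun p z => o (pi1 p) z)); recursion.
Qed.

Lemma step_push o v t d K :
  step o <<v, push <<t, d>> K>> = apply_frame o t d v K.
Proof.
  unfold step, push; rewrite !pi2_pair, pi1_pair.
  replace (S <<<<t, d>>, K>> - 1) with <<<<t, d>>, K>> by lia.
  cbn [Nat.eqb]; cbv zeta; now rewrite !pi1_pair, !pi2_pair.
Qed.

Lemma step_halted o a : pi2 a = 0 -> step o a = a.
Proof. unfold step; now intros ->. Qed.

Lemma iter_step_halted o t s a b :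
  t <= s -> Nat.iter t (step o) a = b -> pi2 b = 0 ->
  Nat.iter s (step o) a = b.
Proof.
  intros L E H; induction L as [|s L IH]; auto.
  rewrite Nat.iter_succ, IH; now apply step_halted.
Qed.

(** [5 + r + 4 * q] is the common shape of the compound codes, with [r] equal to 0, 1, 2, 3 for
    [Pair], [Comp], [Prec], [Mu]; one decoding argument serves all four. *)
Lemma apply_code_compound o r q v K :
  r < 4 ->
  apply_code o (5 + r + 4 * q) v K =
  if r =? 0 then
    <<v, push (fr_code (pi1 q)) (push (fr_pair (pi2 q) v) K)>>
  else if r =? 1 then
    <<v, push (fr_code (pi2 q)) (push (fr_code (pi1 q)) K)>>
  else if r =? 2 then
    if pi2 v =? 0 then <<pi1 v, push (fr_code (pi1 q)) K>>
    else <<<<pi1 v, pi2 v - 1>>,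
           push (fr_code (5 + r + 4 * q)) (push (fr_left (pi2 v - 1))
             (push (fr_left (pi1 v)) (push (fr_code (pi2 q)) K)))>>
  else <<<<v, 0>>, push (fr_code q) (push (fr_mu q <<v, 0>>) K)>>.
Proof.
  intros L; unfold apply_code.
  change (5 + r + 4 * q) with (S (S (S (S (S (r + 4 * q)))))).
  cbn [Nat.eqb]; cbv zeta.
  replace (S (S (S (S (S (r + 4 * q))))) - 5) with (r + 4 * q) by lia.
  rewrite quarter_spec by auto.
  now replace (r + 4 * q - (q + q + q + q)) with r by lia.
Qed.

Section Steps.
Variables (o : nat -> nat) (K : nat).

Local Notation app c := (push (fr_code (encode c))).

Lemma step_Zero x : step o <<x, app Zero K>> = <<0, K>>.
Proof. apply step_push. Qed.

Lemma step_Succ x : step o <<x, app Succ K>> = <<S x, K>>.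
Proof. apply step_push. Qed.

Lemma step_Fst x y : step o <<<<x, y>>, app Fst K>> = <<x, K>>.
Proof. rewrite <- (pi1_pair x y) at 2; apply step_push. Qed.

Lemma step_Snd x y : step o <<<<x, y>>, app Snd K>> = <<y, K>>.
Proof. rewrite <- (pi2_pair x y) at 2; apply step_push. Qed.

Lemma step_Query x : step o <<x, app Query K>> = <<o x, K>>.
Proof. apply step_push. Qed.

Lemma step_Pair f g x :
  step o <<x, app (Pair f g) K>> =
  <<x, app f (push (fr_pair (encode g) x) K)>>.
Proof.
  unfold fr_code at 1; rewrite step_push.
  unfold apply_frame; cbn [Nat.eqb encode].
  now rewrite (apply_code_compound o 0), pi1_pair, pi2_pair by lia.
Qed.

Lemma step_Comp f g x :
  step o <<x, app (Comp f g) K>> = <<x, app g (app f K)>>.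
Proof.
  unfold fr_code at 1; rewrite step_push.
  unfold apply_frame; cbn [Nat.eqb encode].
  now rewrite (apply_code_compound o 1), pi1_pair, pi2_pair by lia.
Qed.

Lemma step_Prec_0 f g x :
  step o <<<<x, 0>>, app (Prec f g) K>> = <<x, app f K>>.
Proof.
  unfold fr_code at 1; rewrite step_push.
  unfold apply_frame; cbn [Nat.eqb encode].
  now rewrite (apply_code_compound o 2), !pi1_pair, !pi2_pair by lia.
Qed.

Lemma step_Prec_S f g x n :
  step o <<<<x, S n>>, app (Prec f g) K>> =
  <<<<x, n>>, app (Prec f g) (push (fr_left n) (push (fr_left x) (app g K)))>>.
Proof.
  unfold fr_code at 1; rewrite step_push.
  unfold apply_frame; cbn [Nat.eqb encode].
  rewrite (apply_code_compound o 2), !pi1_pair, !pi2_pair by lia.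
  cbn [Nat.eqb]; now replace (S n - 1) with n by lia.
Qed.

Lemma step_Mu f x :
  step o <<x, app (Mu f) K>> =
  <<<<x, 0>>, app f (push (fr_mu (encode f) <<x, 0>>) K)>>.
Proof.
  unfold fr_code at 1; rewrite step_push.
  unfold apply_frame; cbn [Nat.eqb encode].
  now rewrite (apply_code_compound o 3) by lia.
Qed.

Lemma step_fr_pair g x v :
  step o <<v, push (fr_pair (encode g) x) K>> =
  <<x, app g (push (fr_left v) K)>>.
Proof.
  unfold fr_pair; rewrite step_push.
  unfold apply_frame; cbn [Nat.eqb]; now rewrite pi1_pair, pi2_pair.
Qed.

Lemma step_fr_left u v : step o <<v, push (fr_left u) K>> = <<<<u, v>>, K>>.
Proof. apply step_push. Qed.

Lemma step_fr_mu_0 f x n :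
  step o <<0, push (fr_mu f <<x, n>>) K>> = <<n, K>>.
Proof.
  unfold fr_mu; rewrite step_push.
  unfold apply_frame; cbn [Nat.eqb]; now rewrite !pi2_pair.
Qed.

Lemma step_fr_mu_S f x n v :
  step o <<S v, push (fr_mu (encode f) <<x, n>>) K>> =
  <<<<x, S n>>, app f (push (fr_mu (encode f) <<x, S n>>) K)>>.
Proof.
  unfold fr_mu at 1; rewrite step_push.
  unfold apply_frame; cbn [Nat.eqb]; cbv zeta.
  now rewrite !pi2_pair, !pi1_pair.
Qed.

End Steps.

Opaque step push fr_code fr_pair fr_left fr_mu.

(** * Completeness of the machine under a converging oracle approximation *)

Definition decides (o : nat -> nat) (A : nat -> Prop) (z : nat) : Prop :=
  (A z -> o z = 1) /\ (~ A z -> o z = 0).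

Definition converges (o : nat -> nat -> nat) (A : nat -> Prop) : Prop :=
  forall z, exists s0, forall s, s0 <= s -> decides (o s) A z.

(** The step count [t] is the same at all late stages; this makes the relation transitive, since
    counts add up and thresholds combine. *)
Definition reaches (o : nat -> nat -> nat) (a b : nat) : Prop :=
  exists t s0, forall s, s0 <= s -> Nat.iter t (step (o s)) a = b.

Lemma reaches_trans o a b c : reaches o a b -> reaches o b c -> reaches o a c.
Proof.
  intros (t & s & H) (t' & s' & H'); exists (t' + t), (s + s').
  intros r L; rewrite Nat.iter_add, H, H' by lia; auto.
Qed.

Lemma reaches_step o a b : (forall s, step (o s) a = b) -> reaches o a b.
Proof. intros H; exists 1, 0; intros s _; apply H. Qed.

(** A halting computation asks finitely many queries, and each answer is correct from some stage on.
    The arbitrary stack [K] lets subcomputations be chained. *)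
Lemma reaches_eval o A c x y K :
  converges o A -> eval A c x y ->
  reaches o <<x, push (fr_code (encode c)) K>> <<y, K>>.
Proof.
  intros C H; revert K; induction H; intros K;
    try (apply reaches_step; intros s;
         first [apply step_Zero | apply step_Succ | apply step_Fst
               | apply step_Snd]; fail).
  - destruct (C x) as [s0 D]; exists 1, s0; intros s L.
    replace <<1, K>> with <<o s x, K>> by (f_equal; now apply D).
    apply step_Query.
  - destruct (C x) as [s0 D]; exists 1, s0; intros s L.
    replace <<0, K>> with <<o s x, K>> by (f_equal; now apply D).
    apply step_Query.
  - eapply reaches_trans; [apply reaches_step; intros; apply step_Pair|].
    eapply reaches_trans; [apply IHeval1|].
    eapply reaches_trans; [apply reaches_step; intros; apply step_fr_pair|].
    eapply reaches_trans; [apply IHeval2|].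
    apply reaches_step; intros; apply step_fr_left.
  - eapply reaches_trans; [apply reaches_step; intros; apply step_Comp|].
    eapply reaches_trans; [apply IHeval1|apply IHeval2].
  - eapply reaches_trans; [apply reaches_step; intros; apply step_Prec_0|].
    apply IHeval.
  - eapply reaches_trans; [apply reaches_step; intros; apply step_Prec_S|].
    eapply reaches_trans; [apply IHeval1|].
    eapply reaches_trans; [apply reaches_step; intros; apply step_fr_left|].
    eapply reaches_trans; [apply reaches_step; intros; apply step_fr_left|].
    apply IHeval2.
  - eapply reaches_trans; [apply reaches_step; intros; apply step_Mu|].
    (* The search loop arrives at every point up to [n], because the values before [n] are
       nonzero. *)
    assert (M : forall m, m <= n ->
      reaches o
        <<<<x, 0>>, push (fr_code (encode f)) (push (fr_mu (encode f) <<x, 0>>) K)>>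
        <<<<x, m>>, push (fr_code (encode f)) (push (fr_mu (encode f) <<x, m>>) K)>>).
    { induction m as [|m IH]; intros L; [exists 0, 0; auto|].
      eapply reaches_trans; [apply IH; lia|].
      eapply reaches_trans; [apply H0; lia|].
      apply reaches_step; intros; apply step_fr_mu_S. }
    eapply reaches_trans; [apply M; auto|].
    eapply reaches_trans; [apply IHeval|].
    apply reaches_step; intros; apply step_fr_mu_0.
Qed.

(** The stage also serves as the step budget, which is harmless because halted configurations do not
    move. *)
Lemma run_eval o A c x y :
  converges o A -> eval A c x y ->
  exists s0, forall s, s0 <= s -> run (o s) s (encode c) x = <<y, 0>>.
Proof.
  intros C H; destruct (reaches_eval o A c x y 0 C H) as (t & s0 & R).
  exists (t + s0); intros s L; apply (iter_step_halted _ t);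
    [lia|apply R; lia|apply pi2_pair].
Qed.

(** * Soundness of the machine for a correct oracle *)

Definition halts (o : nat -> nat) (t a : nat) : Prop :=
  pi2 (Nat.iter t (step o) a) = 0.

Lemma halts_step o t v f K b :
  step o <<v, push f K>> = b -> halts o t <<v, push f K>> ->
  exists t', t' < t /\ halts o t' b.
Proof.
  intros E H; destruct t as [|t].
  - exfalso; unfold halts in H; cbn in H; rewrite pi2_pair in H; discriminate.
  - exists t; split; auto; unfold halts in H.
    now rewrite Nat.iter_succ_r, E in H.
Qed.

(** A run that empties the stack must first finish the top frame and expose [K]. Each step or
    subcomputation strictly lowers the remaining budget, so strong induction on [t] applies even
    where a code calls itself, as in [Prec]. *)
Lemma halts_eval o A :
  (forall z, decides o A z) ->
  forall t c x K, halts o t <<x, push (fr_code (encode c)) K>> ->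
  exists y t', t' < t /\ eval A c x y /\ halts o t' <<y, K>>.
Proof.
  intros D t; induction t as [t IH] using lt_wf_ind; intros c x K H.
  destruct c.
  - apply (halts_step _ _ _ _ _ _ (step_Zero _ _ _)) in H
      as (t' & L & H); eauto 10 using eval.
  - apply (halts_step _ _ _ _ _ _ (step_Succ _ _ _)) in H
      as (t' & L & H); eauto 10 using eval.
  - rewrite <- (pair_eta x) in H |- *.
    apply (halts_step _ _ _ _ _ _ (step_Fst _ _ _ _)) in H
      as (t' & L & H); eauto 10 using eval.
  - rewrite <- (pair_eta x) in H |- *.
    apply (halts_step _ _ _ _ _ _ (step_Snd _ _ _ _)) in H
      as (t' & L & H); eauto 10 using eval.
  - apply (halts_step _ _ _ _ _ _ (step_Query _ _ _)) in H as (t' & L & H).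
    destruct (D x) as [D1 D0], (classic (A x)) as [a | a];
      [rewrite D1 in H by auto | rewrite D0 in H by auto]; eauto 10 using eval.
  - apply (halts_step _ _ _ _ _ _ (step_Pair _ _ _ _ _)) in H as (t1 & L1 & H).
    apply IH in H as (y & t2 & L2 & E1 & H); [|lia].
    apply (halts_step _ _ _ _ _ _ (step_fr_pair _ _ _ _ _)) in H
      as (t3 & L3 & H).
    apply IH in H as (z & t4 & L4 & E2 & H); [|lia].
    apply (halts_step _ _ _ _ _ _ (step_fr_left _ _ _ _)) in H
      as (t5 & L5 & H).
    exists <<y, z>>, t5; repeat split; eauto using eval; lia.
  - apply (halts_step _ _ _ _ _ _ (step_Comp _ _ _ _ _)) in H as (t1 & L1 & H).
    apply IH in H as (y & t2 & L2 & E1 & H); [|lia].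
    apply IH in H as (z & t3 & L3 & E2 & H); [|lia].
    exists z, t3; repeat split; eauto using eval; lia.
  - rewrite <- (pair_eta x) in H |- *.
    generalize dependent (pi1 x); generalize (pi2 x); intros n w H.
    destruct n as [|n].
    + apply (halts_step _ _ _ _ _ _ (step_Prec_0 _ _ _ _ _)) in H
        as (t1 & L1 & H).
      apply IH in H as (y & t2 & L2 & E1 & H); [|lia].
      exists y, t2; repeat split; eauto using eval; lia.
    + apply (halts_step _ _ _ _ _ _ (step_Prec_S _ _ _ _ _ _)) in H
        as (t1 & L1 & H).
      apply IH in H as (y & t2 & L2 & E1 & H); [|lia].
      apply (halts_step _ _ _ _ _ _ (step_fr_left _ _ _ _)) in H
        as (t3 & L3 & H).
      apply (halts_step _ _ _ _ _ _ (step_fr_left _ _ _ _)) in H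
        as (t4 & L4 & H).
      apply IH in H as (z & t5 & L5 & E2 & H); [|lia].
      exists z, t5; repeat split; eauto using eval; lia.
  - apply (halts_step _ _ _ _ _ _ (step_Mu _ _ _ _)) in H as (t1 & L1 & H).
    (* The search loop needs its own induction on the remaining budget; [k] accumulates the nonzero
       values that [eval_Mu] asks for. *)
    assert (M : forall t1, t1 < t -> forall n (k : nat -> nat),
      (forall m, m < n -> eval A c <<x, m>> (S (k m))) ->
      halts o t1 <<<<x, n>>, push (fr_code (encode c))
                               (push (fr_mu (encode c) <<x, n>>) K)>> ->
      exists y t', t' < t /\ eval A (Mu c) x y /\ halts o t' <<y, K>>).
    { clear t1 L1 H.
      induction t1 as [t1 IHt] using lt_wf_ind; intros L n k Hk H.
      apply IH in H as (y & t2 & L2 & E1 & H); [|lia].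
      destruct y as [|y].
      - apply (halts_step _ _ _ _ _ _ (step_fr_mu_0 _ _ _ _ _)) in H
          as (t3 & L3 & H).
        exists n, t3; repeat split; eauto using eval; lia.
      - apply (halts_step _ _ _ _ _ _ (step_fr_mu_S _ _ _ _ _ _)) in H
          as (t3 & L3 & H).
        apply (IHt t3) with (n := S n) (k := fun m => if m =? n then y else k m)
          in H; auto; try lia.
        intros m Lm; destruct (Nat.eqb_spec m n) as [->|]; auto.
        apply Hk; lia. }
    apply (M t1 L1 0 (fun _ => 0)); auto; lia.
Qed.

(** * Low sets are [Sigma02] *)

Definition no_oracle (_ : nat) : nat := 0.

Lemma no_oracle_decides z : decides no_oracle empty z.
Proof. split; [intros []|auto]. Qed.

Lemma no_oracle_converges : converges (fun _ => no_oracle) empty.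
Proof. intros z; exists 0; intros; apply no_oracle_decides. Qed.

Definition jump_approx (s e : nat) : nat :=
  Nat.b2n (pi2 (run no_oracle s e e) =? 0).

(** A program that halts on its own index is seen to do so from some stage on; by soundness, one
    that does not is never reported as halting. *)
Lemma jump_approx_converges : converges jump_approx (jump empty).
Proof.
  intros e; destruct (classic (jump empty e)) as [J | J].
  - destruct J as (c & <- & y & H).
    destruct (run_eval _ _ _ _ _ no_oracle_converges H) as [s0 R].
    exists s0; intros s L; split; [intros _|intros []; exists c; eauto].
    unfold jump_approx; now rewrite R, pi2_pair.
  - exists 0; intros s _; split; [tauto|intros _].
    unfold jump_approx; destruct (Nat.eqb_spec (pi2 (run no_oracle s e e)) 0)
      as [E|]; auto; destruct J.
    destruct (encode_surj e) as [c <-].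
    destruct (halts_eval no_oracle empty no_oracle_decides s c _ _ E)
      as (y & _ & _ & H & _).
    exists c; eauto.
Qed.

(** One half of the limit lemma: [u] names a stage from which the approximated computation answers
    1, and [v] runs over the later stages. The configuration [<<1, 0>>] is output 1 with an empty
    stack. *)
Lemma turing_le_Sigma02 o B S :
  recursive (fun p => o (pi1 p) (pi2 p)) -> converges o B -> turing_le S B ->
  Sigma02 S.
Proof.
  intros Ho C [c H].
  exists (fun x u v =>
            (run (o (u + v)) (u + v) (encode c) x =? <<1, 0>>) = true).
  split.
  - apply (recursiveb_computable3 (fun x u v =>
            run (o (u + v)) (u + v) (encode c) x =? <<1, 0>>)).
    recursion.
    apply (recursive_run (fun p z => o (pi1 (pi2 p) + pi2 (pi2 p)) z));
      recursion.
  - intros x; split.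
    + intros Sx; apply H in Sx.
      destruct (run_eval _ _ _ _ _ C Sx) as [u R].
      exists u; intros v; apply Nat.eqb_eq, R; lia.
    + intros [u R]; apply NNPP; intros N; apply H in N.
      destruct (run_eval _ _ _ _ _ C N) as [s0 Q].
      (* At stage [u + s0] the computation has already settled on 0. *)
      specialize (R s0); apply Nat.eqb_eq in R; rewrite Q in R by lia.
      apply pair_inj in R as [R _]; discriminate.
Qed.

(** Many-one reduction of [S] to its jump: [f x] is the index of a program that ignores its input
    and halts exactly when [x] is in [S]. *)
Lemma turing_le_jump S :
  exists f, recursive f /\ forall x, S x <-> jump S (f x).
Proof.
  assert (I : recursive (fun v => 1 - v)) by recursion.
  destruct I as [i Hi].
  (* The searched function is [1 - S(x)] whatever the search variable, so the search stops at once
     or never. *)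
  set (d := Mu (Comp i (Comp Query Fst))).
  (* [k x] is the index of the constant program [x]: 0 is [encode Zero], and [6 + 4 * <<1, y>>]
     composes [Succ] with the program of index [y]. *)
  set (k := fun x => primrec 0 (fun _ y => 6 + 4 * <<1, y>>) x).
  assert (Hk : forall x, exists c, encode c = k x /\ forall y, eval S c y x).
  { induction x as [|x (c & E & H)].
    - exists Zero; split; constructor.
    - exists (Comp Succ c); split; [cbn [encode]; now rewrite E|].
      intros; econstructor; eauto; constructor. }
  assert (Hd : forall x, S x <-> exists y, eval S d x y).
  { intros x; split.
    - intros Sx; exists 0; apply eval_Mu with (k := fun _ => 0); [lia|].
      repeat econstructor; eauto; apply (Hi S 1).
    - intros [n H]; apply NNPP; intros N.
      assert (E : eval S (Comp i (Comp Query Fst)) <<x, n>> 1).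
      { econstructor; [econstructor; [constructor|now apply eval_Query_out]|].
        apply (Hi S 0). }
      inversion H as [| | | | | | | | | |? ? ? ? ? H0]; subst.
      apply (eval_det _ _ _ _ E) in H0; discriminate. }
  exists (fun x => 6 + 4 * <<encode d, k x>>); split.
  (* The multiplication by 4 unfolds to sums, which the tactic handles. *)
  - unfold k; cbn [Nat.mul]; recursion.
  - intros x; destruct (Hk x) as (c & E & H).
    rewrite Hd, <- E; split.
    + intros [y Hy]; exists (Comp d c); split; auto.
      exists y; econstructor; eauto.
    + intros (c' & E' & y & Hy).
      change (encode c' = encode (Comp d c)) in E'.
      apply encode_inj in E'; subst c'.
      inversion Hy; subst.
      exists y; match goal with G : eval S c _ ?z |- _ =>
        apply (eval_det _ _ _ _ (H _)) in G; subst end; auto.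
Qed.

Lemma low_Sigma02 S : low S -> Sigma02 S.
Proof.
  intros [c H]; apply (turing_le_Sigma02 jump_approx (jump empty)).
  - unfold jump_approx; change (recursiveb (fun p =>
      pi2 (run no_oracle (pi1 p) (pi2 p) (pi2 p)) =? 0)); recursion.
    apply (recursive_run (fun _ => no_oracle)); unfold no_oracle; recursion.
  - apply jump_approx_converges.
  - destruct (turing_le_jump S) as (f & [d Hd] & Hf).
    exists (Comp c d); intros x; rewrite Hf; specialize (H (f x)).
    split; intros J; apply H in J; econstructor; eauto.
Qed.

(** * The tournament *)

(** Course-of-values recursion: [h e] receives all earlier values, packed into one number. *)
Definition stack (h : nat -> nat -> nat) (n : nat) : nat :=
  primrec 0 (fun e L => <<h e L, L>>) n.

(* Entries are pushed on the left, so entry [e] of a stack of height [n] sits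
   under [n - 1 - e] others. *)
Definition entry (n L e : nat) : nat := pi1 (Nat.iter (n - 1 - e) pi2 L).

Lemma entry_stack h n e : e < n -> entry n (stack h n) e = h e (stack h e).
Proof.
  induction n as [|n IH]; intros L; [lia|].
  change (stack h (S n)) with <<h n (stack h n), stack h n>>; unfold entry.
  destruct (Nat.eq_dec e n) as [->|N].
  - replace (S n - 1 - n) with 0 by lia; apply pi1_pair.
  - replace (S n - 1 - e) with (S (n - 1 - e)) by lia.
    rewrite Nat.iter_succ_r, pi2_pair; apply IH; lia.
Qed.

(* Row [s] lists, for each [e < s], a pair [<<a, b>>] meaning that [s] beats
   [a] and is beaten by [b]; [<<s, s>>] stands for no pair. *)
Definition beats (s L x : nat) : bool := any s (fun i => pi1 (entry s L i) =? x).

(** The rows are a parameter because the construction of a row reads the earlier ones off a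
    stack. *)
Definition edge_of (row : nat -> nat) (x y : nat) : bool :=
  if y <? x then beats x (row x) y
  else (x <? y) && negb (beats y (row y) x).

(* A number [p = <<x, u>>] is a witness for [x] in the [Sigma02] set whose
   matrix is computed by the code numbered [e]. *)
Definition refuted (s e p : nat) : bool :=
  any s (fun v => run no_oracle s e <<pi1 p, <<pi2 p, v>>>> =? <<0, 0>>).

Definition used (e L x : nat) : bool :=
  any e (fun i => (pi1 (entry e L i) =? x) || (pi2 (entry e L i) =? x)).

Definition candidate (s e L p : nat) : bool :=
  negb (refuted s e p) && negb (used e L (pi1 p)).

Definition candidate2 (s e L q : nat) : bool :=
  candidate s e L q && negb (pi1 q =? pi1 (least s (candidate s e L))).

(* [H] is the stack of the rows before [s]. *)
Definition choice (s H e L : nat) : nat :=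
  let a := pi1 (least s (candidate s e L)) in
  let b := pi1 (least s (candidate2 s e L)) in
  if any s (candidate2 s e L) then
    if edge_of (entry s H) a b then <<a, b>> else <<b, a>>
  else <<s, s>>.

(** Two nested course-of-values recursions: over the indices within a row, and over the rows. *)
Definition next_row (s H : nat) : nat := stack (choice s H) s.
Definition history (s : nat) : nat := stack next_row s.
Definition row (s : nat) : nat := next_row s (history s).
Definition edge (x y : nat) : bool := edge_of row x y.

(** * Computability of the tournament *)

Lemma recursiveb_refuted s e p :
  recursive s -> recursive e -> recursive p ->
  recursiveb (fun x => refuted (s x) (e x) (p x)).
Proof.
  intros; unfold refuted; recursion.
  apply (recursive_run (fun _ => no_oracle)); unfold no_oracle; recursion.
Qed.

Lemma recursive_entry n L e :
  recursive n -> recursive L -> recursive e ->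
  recursive (fun x => entry (n x) (L x) (e x)).
Proof.
  intros; unfold entry; recursion.
Qed.

Lemma recursiveb_candidate s e L p :
  recursive s -> recursive e -> recursive L -> recursive p ->
  recursiveb (fun x => candidate (s x) (e x) (L x) (p x)).
Proof.
  intros; unfold candidate, used.
  recursion; first [apply recursiveb_refuted | apply recursive_entry]; recursion.
Qed.

Lemma recursiveb_candidate2 s e L p :
  recursive s -> recursive e -> recursive L -> recursive p ->
  recursiveb (fun x => candidate2 (s x) (e x) (L x) (p x)).
Proof.
  intros; unfold candidate2; recursion; apply recursiveb_candidate; recursion.
Qed.

Lemma recursiveb_edge_of (r : nat -> nat -> nat) f g :
  recursive (fun p => r (pi1 p) (pi2 p)) -> recursive f -> recursive g ->
  recursiveb (fun x => edge_of (r x) (f x) (g x)).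
Proof.
  intros; unfold edge_of, beats; recursion; apply recursive_entry; recursion.
Qed.

Lemma recursive_row : recursive row.
Proof.
  assert (C : recursive (fun x => choice (pi1 (pi1 x)) (pi2 (pi1 x))
                (pi1 (pi2 x)) (pi2 (pi2 x)))).
  { unfold choice; cbv zeta; recursion.
    2: apply (recursiveb_edge_of (fun x => entry (pi1 (pi1 x)) (pi2 (pi1 x)))).
    all: recursion;
      first [apply recursiveb_candidate | apply recursiveb_candidate2
            | apply recursive_entry]; recursion. }
  assert (N : recursive (fun x => next_row (pi1 x) (pi2 x))).
  { unfold next_row, stack; recursion. }
  unfold row, history, stack; apply (recursive_app2 next_row); recursion.
  apply (recursive_primrec (fun _ => 0) (fun _ i L => <<next_row i L, L>>));
    recursion.
Qed.

Lemma edge_computable : computable2 (fun x y => edge x y = true).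
Proof.
  apply recursiveb_computable2.
  apply (recursiveb_edge_of (fun _ => row)); recursion.
  apply (recursive_comp row); [apply recursive_row|recursion].
Qed.

(** * Tournament laws and the content of a row *)

Lemma edge_irrefl x : edge x x = false.
Proof. unfold edge, edge_of; now rewrite Nat.ltb_irrefl. Qed.

Lemma edge_opp x y : x <> y -> edge y x = negb (edge x y).
Proof.
  intros N; unfold edge, edge_of.
  destruct (Nat.ltb_spec x y), (Nat.ltb_spec y x); try lia; cbn [andb]; auto.
  now rewrite negb_involutive.
Qed.

Definition chosen (s e : nat) : nat := entry s (row s) e.

(** The partial stack consulted at index [e] agrees with the finished row, so [used] can be restated
    through [chosen]. *)
Lemma entry_part s e i :
  i < e -> e <= s -> entry e (stack (choice s (history s)) e) i = chosen s i.
Proof.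
  intros L L'; unfold chosen, row, next_row; now rewrite !entry_stack by lia.
Qed.

Lemma edge_of_ext r r' x y :
  (forall z, z <= x \/ z <= y -> r z = r' z) -> edge_of r x y = edge_of r' x y.
Proof. intros E; unfold edge_of; now rewrite !E by auto. Qed.

Lemma least_any n P : any n P = true -> least n P < n /\ P (least n P) = true.
Proof.
  unfold any; rewrite Nat.ltb_lt; auto using least_sat.
Qed.

Definition free (s e x : nat) : Prop :=
  forall i, i < e -> x <> pi1 (chosen s i) /\ x <> pi2 (chosen s i).

Lemma free_used s e x :
  e <= s ->
  used e (stack (choice s (history s)) e) x = false <-> free s e x.
Proof.
  intros L; unfold used, free; rewrite <- not_true_iff_false, any_spec; split.
  - intros N i Hi.
    split; intros ->; apply N; exists i; rewrite entry_part, !Nat.eqb_refl by lia;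
      auto using orb_true_r.
  - intros F (i & Hi & E); rewrite entry_part in E by lia.
    apply orb_true_iff in E; rewrite !Nat.eqb_eq in E.
    destruct (F i Hi), E; congruence.
Qed.

Definition eligible (s e p : nat) : Prop :=
  refuted s e p = false /\ free s e (pi1 p).

(** The bound [N] is kept apart from the stage [s]: in the diagonalization [N] stays fixed while [s]
    is taken large. *)
Definition two_eligible (s e N : nat) : Prop :=
  exists p q, p < N /\ q < N /\ eligible s e p /\ eligible s e q /\
    pi1 p <> pi1 q.

(** The last clause comes from taking least witnesses: any bound that admits a suitable pair also
    bounds the chosen pair. *)
Lemma chosen_cases s e :
  e < s ->
  (chosen s e = <<s, s>> /\ ~ two_eligible s e s) \/
  exists p q, p < s /\ q < s /\ eligible s e p /\ eligible s e q /\
    edge (pi1 p) (pi1 q) = true /\ chosen s e = <<pi1 p, pi1 q>> /\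
    forall N, two_eligible s e N -> p < N /\ q < N.
Proof.
  intros L; unfold chosen, row at 1 2, next_row; rewrite entry_stack by auto.
  set (P := stack (choice s (history s)) e).
  assert (Cand : forall p, candidate s e P p = true <-> eligible s e p).
  { intros p; unfold candidate, eligible.
    rewrite andb_true_iff, !negb_true_iff.
    unfold P; now rewrite free_used by lia. }
  unfold choice; fold P; set (p0 := least s (candidate s e P)).
  set (q0 := least s (candidate2 s e P)).
  (* Of two eligible witnesses naming distinct numbers, at least one names a number other than that
     of [p0], hence is a second candidate. *)
  assert (Two : forall N, two_eligible s e N ->
            p0 < N /\ exists r, r < N /\ candidate2 s e P r = true).
  { intros N (p & q & Hp & Hq & Ep & Eq & D).
    apply Cand in Ep, Eq; split.
    - apply Nat.le_lt_trans with p; auto; now apply least_le.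
    - unfold candidate2; fold p0.
      destruct (Nat.eq_dec (pi1 p) (pi1 p0)) as [F|F];
        [exists q; rewrite Eq | exists p; rewrite Ep]; split; auto;
        apply negb_true_iff, Nat.eqb_neq; congruence. }
  destruct (any s (candidate2 s e P)) eqn:Y.
  - right; apply least_any in Y as [Lq Y]; fold q0 in Lq, Y.
    assert (Low : forall N, two_eligible s e N -> p0 < N /\ q0 < N).
    { intros N T; apply Two in T as (Lp & r & Lr & Hr); split; auto.
      apply Nat.le_lt_trans with r; auto; now apply least_le. }
    unfold candidate2 in Y; fold p0 in Y.
    apply andb_true_iff in Y as [Cq N].
    apply negb_true_iff, Nat.eqb_neq in N.
    (* A second candidate is also a candidate, so [p0 <= q0 < s] and the search for [p0] did not end
       in its default value. *)
    assert (Lp : p0 <= q0) by now apply least_le.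
    assert (Cp : candidate s e P p0 = true) by (apply least_sat; fold p0; lia).
    apply Cand in Cp, Cq.
    (* The two numbers are below [s], where the stacked rows are the final ones. *)
    rewrite (edge_of_ext _ row).
    2: { intros z Hz; apply entry_stack.
         pose proof (pi1_le p0); pose proof (pi1_le q0); lia. }
    fold (edge (pi1 p0) (pi1 q0)).
    destruct (edge (pi1 p0) (pi1 q0)) eqn:E.
    + exists p0, q0; repeat (split; [assumption || lia|]); auto.
    + exists q0, p0; repeat (split; [assumption || lia|]).
      split; [rewrite edge_opp, E; auto|].
      split; auto; intros M T; apply Low in T; tauto.
  - left; split; auto; intros T; apply Two in T as (_ & r & Lr & Cr).
    rewrite (proj2 (any_spec _ _)) in Y; [discriminate|eauto].
Qed.

Lemma edge_chosen_1 s e :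
  e < s -> pi1 (chosen s e) < s -> edge s (pi1 (chosen s e)) = true.
Proof.
  intros L L'; unfold edge, edge_of; rewrite (proj2 (Nat.ltb_lt _ _) L').
  apply any_spec; exists e; split; auto; apply Nat.eqb_refl.
Qed.

(** No entry may tell [s] to beat [b], the second number of entry [e]. An earlier entry cannot since
    [b] was free at [e], entry [e] itself since its numbers differ, a later one since its first
    number is free of [b] or is the default [s]. *)
Lemma edge_chosen_2 s e :
  e < s -> pi2 (chosen s e) < s -> edge (pi2 (chosen s e)) s = true.
Proof.
  intros L L'; rewrite edge_opp by lia.
  unfold edge, edge_of; rewrite (proj2 (Nat.ltb_lt _ _) L').
  apply negb_true_iff, not_true_iff_false; unfold beats; rewrite any_spec.
  intros (i & Hi & E); apply Nat.eqb_eq in E; fold (chosen s i) in E.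
  destruct (chosen_cases s e L)
    as [[C _] | (p & q & _ & _ & _ & [_ F] & N & C & _)];
    rewrite C, pi2_pair in E, L'; [lia|].
  destruct (lt_eq_lt_dec i e) as [[D|D]|D].
  - destruct (F i D); congruence.
  - subst i; rewrite C, pi1_pair in E; rewrite E, edge_irrefl in N; discriminate.
  - destruct (chosen_cases s i Hi)
      as [[C' _] | (p' & q' & _ & _ & [_ F'] & _ & _ & C' & _)];
      rewrite C', pi1_pair in E; [lia|].
    destruct (F' e D) as [_ G]; rewrite C, pi2_pair in G; auto.
Qed.

(** * Diagonalization against an infinite [Sigma02] set *)

Lemma infinite_list S n :
  infinite S -> exists l, NoDup l /\ length l = n /\ forall x, In x l -> S x.
Proof.
  intros I; induction n as [|n (l & D & E & H)].
  - exists nil; repeat split; [constructor|intros x []].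
  (* If [l] could not be extended by a new member, it would list all of [S]. *)
  - apply NNPP; intros N; apply I; exists l; intros x Sx.
    apply NNPP; intros Nx; apply N; exists (x :: l).
    repeat split; [now constructor|cbn; auto|].
    intros y [<-|Hy]; auto.
Qed.

Lemma eventually_all (P : nat -> nat -> Prop) N :
  (forall p, exists s0, forall s, s0 <= s -> P p s) ->
  exists s0, forall s p, s0 <= s -> p < N -> P p s.
Proof.
  intros H; induction N as [|N [s0 IH]]; [exists 0; lia|].
  destruct (H N) as [s1 H1]; exists (s0 + s1); intros s p L Lp.
  destruct (Nat.eq_dec p N) as [->|]; [apply H1; lia|apply IH; lia].
Qed.

Lemma pigeonhole (l m : list nat) :
  NoDup l -> length m < length l -> exists x, In x l /\ ~ In x m.
Proof.
  intros D L; apply NNPP; intros N.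
  enough (length l <= length m) by lia.
  apply NoDup_incl_length; auto; intros x Hx; apply NNPP; eauto.
Qed.

(** A true witness is never refuted, because outputs are unique; a false one is refuted once the
    stage exceeds a counterexample [v] and the time to compute it. *)
Lemma refuted_limit R c :
  (forall p, (R (pi1 p) (pi1 (pi2 p)) (pi2 (pi2 p)) -> eval empty c p 1) /\
             (~ R (pi1 p) (pi1 (pi2 p)) (pi2 (pi2 p)) -> eval empty c p 0)) ->
  forall p, exists s0, forall s, s0 <= s ->
    refuted s (encode c) p = false <-> forall v, R (pi1 p) (pi2 p) v.
Proof.
  intros H p.
  assert (O : forall v, (R (pi1 p) (pi2 p) v ->
                         eval empty c <<pi1 p, <<pi2 p, v>>>> 1) /\
                        (~ R (pi1 p) (pi2 p) v ->
                         eval empty c <<pi1 p, <<pi2 p, v>>>> 0)).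
  { intros v; specialize (H <<pi1 p, <<pi2 p, v>>>>).
    now rewrite !pi2_pair, !pi1_pair in H. }
  destruct (classic (forall v, R (pi1 p) (pi2 p) v)) as [Y|N].
  - exists 0; intros s _; split; auto; intros _.
    apply not_true_iff_false; unfold refuted; rewrite any_spec.
    intros (v & _ & E); apply Nat.eqb_eq in E.
    destruct (run_eval _ _ _ _ _ no_oracle_converges (proj1 (O v) (Y v)))
      as [s1 G].
    (* By stage [s + s1] both runs have halted, with outputs 0 and 1. *)
    specialize (G (s + s1) ltac:(lia)).
    unfold run in G, E.
    rewrite (iter_step_halted _ s _ _ <<0, 0>>) in G;
      [apply pair_inj in G as [G _]; discriminate|lia|auto|apply pi2_pair].
  - apply not_all_ex_not in N as [v N].
    destruct (run_eval _ _ _ _ _ no_oracle_converges (proj2 (O v) N))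
      as [s1 G].
    exists (s1 + S v); intros s L; split; [|intros Y; now destruct N].
    intros E; exfalso; apply not_true_iff_false in E; apply E.
    apply any_spec; exists v; split; [lia|].
    apply Nat.eqb_eq, G; lia.
Qed.

Lemma Sigma02_not_transitive S :
  infinite_transitive_subtournament (fun x y => edge x y = true) S ->
  ~ Sigma02 S.
Proof.
  intros [I Tr] (R & CR & HR); destruct (computable3_code R CR) as [c Hc].
  set (e := encode c).
  (* Indices below [e] use at most [2 * e] numbers; two more members of [S] must remain. *)
  destruct (infinite_list S (2 * e + 2) I) as (l & D & Len & Hl).
  assert (W : exists N, forall x, In x l ->
            exists p, p < N /\ pi1 p = x /\ forall v, R (pi1 p) (pi2 p) v).
  { clear D Len; induction l as [|x l IH]; [exists 0; intros x []|].
    destruct IH as [N IH]; [intros y Hy; apply Hl; now right|].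
    destruct (proj1 (HR x) (Hl x (or_introl eq_refl))) as [u Hu].
    exists (N + Datatypes.S <<x, u>>); intros y [<-|Hy].
    - exists <<x, u>>; rewrite pi1_pair, pi2_pair; repeat split; auto; lia.
    - destruct (IH y Hy) as (p & Lp & Hp); exists p; split; auto; lia. }
  destruct W as [N W].
  destruct (eventually_all _ N (refuted_limit R c Hc)) as [s0 Lim].
  (* One more member than there are numbers up to [s0 + N + e], so some [s] in [S] exceeds this
     bound: refutation has settled below [N], and row [s] handles index [e]. *)
  destruct (infinite_list S (s0 + N + e + 2) I) as (l' & D' & Len' & Hl').
  destruct (pigeonhole l' (seq 0 (s0 + N + e + 1)) D') as (s & Hs & Big).
  { rewrite length_seq; lia. }
  apply Hl' in Hs; rewrite in_seq in Big.
  assert (Found : two_eligible s e N).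
  { set (m := map (fun i => pi1 (chosen s i)) (seq 0 e) ++
              map (fun i => pi2 (chosen s i)) (seq 0 e)).
    assert (Lm : length m = 2 * e).
    { unfold m; rewrite length_app, !length_map, length_seq; lia. }
    assert (Fm : forall x, ~ In x m -> free s e x).
    { intros x Nx i Hi; split; intros ->; apply Nx; unfold m;
        rewrite in_app_iff; [left|right];
        apply (in_map (fun i => _ (chosen s i))), in_seq; lia. }
    destruct (pigeonhole l m D) as (x & Hx & Nx); [lia|].
    destruct (pigeonhole l (x :: m) D) as (y & Hy & Ny); [cbn; lia|].
    destruct (W x Hx) as (p & Lp & <- & Rp), (W y Hy) as (q & Lq & <- & Rq).
    exists p, q; split; [auto|split; [auto|split; [|split]]].
    - split; [apply Lim; auto; lia|now apply Fm].
    - split; [apply Lim; auto; lia|].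
      apply Fm; intros ?; apply Ny; now right.
    - intros E; apply Ny; now left. }
  destruct (chosen_cases s e ltac:(lia))
    as [[_ C] | (p & q & _ & _ & [Rp _] & [Rq _] & E & C & B)].
  { apply C; destruct Found as (p & q & ? & ? & Fd).
    exists p, q; split; [lia|split; [lia|exact Fd]]. }
  (* Below [N], unrefuted at stage [s] means true, so both chosen numbers lie in [S]. *)
  destruct (B N Found) as [Lp Lq].
  pose proof (edge_chosen_1 s e) as E1; pose proof (edge_chosen_2 s e) as E2.
  rewrite C, pi1_pair in E1; rewrite C, pi2_pair in E2.
  pose proof (pi1_le p); pose proof (pi1_le q).
  specialize (E1 ltac:(lia) ltac:(lia)); specialize (E2 ltac:(lia) ltac:(lia)).
  assert (Sp : S (pi1 p)) by (apply HR; exists (pi2 p); apply (Lim s); auto; lia).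
  assert (Sq : S (pi1 q)) by (apply HR; exists (pi2 q); apply (Lim s); auto; lia).
  (* Transitivity along [pi1 p], [pi1 q], [s] contradicts the edge from [s] back to [pi1 p]. *)
  pose proof (Tr _ _ _ Sp Sq Hs E E2) as X.
  rewrite edge_opp, E1 in X; [discriminate|lia].
Qed.

Theorem theorem1p9 :
  exists T : nat -> nat -> Prop,
    computable2 T /\
    tournament T /\
    (forall S : nat -> Prop,
        infinite_transitive_subtournament T S -> ~ Delta02 S) /\
    (forall S : nat -> Prop,
        infinite_transitive_subtournament T S -> ~ Sigma02 S) /\
    (forall S : nat -> Prop,
        infinite_transitive_subtournament T S -> ~ low S).
Proof.
  exists (fun x y => edge x y = true).
  split; [apply edge_computable|].
  split.
  { split; [intros x; rewrite edge_irrefl; discriminate|].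
    intros x y N; rewrite (edge_opp x y N); destruct (edge x y); cbn; auto. }
  repeat split; intros S HS.
  - intros [H _]; now apply (Sigma02_not_transitive S).
  - now apply Sigma02_not_transitive.
  - intros H; apply (Sigma02_not_transitive S); auto using low_Sigma02.
Qed.
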